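(* Let $G$ be a graph of arboricity at most $\alpha$, let $b\ge1$ be an integer, $\eta\in(0,1]$, and $\Lambda_b:=5(1+5/\eta)\cdot2\alpha+(b-1)$. Suppose $H$ is obtained by marking an arbitrary set of $\min(\deg(v),\Lambda_b)$ edges incident to each vertex $v$ and taking the subgraph consisting of all edges marked by both endpoints. Then \[ \mu_b(H)\le\mu_b(G)\le(1+\eta)\mu_b(H). \] In particular, any $(\beta,\zeta)$-approximate maximum $b$-matching of $H$ is a $(\beta(1+\eta),\zeta(1+\eta))$-approximate maximum $b$-matching of $G$. Moreover this holds for $H=\textsc{ContractionSparsify}_\pi(G,\Lambda_b)$ for any total order $\pi$ of the unordered vertex pairs.
   Context: $\mu_b(\cdot)$ denotes the size of a maximum $b$-matching (a set of edges with every vertex of degree at most $b$). The arboricity of a graph is the minimum number of forests partitioning its edges. A $b$-matching $F$ of a graph $K$ is a $(\beta,\zeta)$-approximate maximum $b$-matching if $|F|\ge\mu_b(K)/\beta-\zeta$. $\textsc{ContractionSparsify}_\pi(G,\Lambda)$: each vertex marks its first $\min(\deg(v),\Lambda)$ incident edges with respect to $\pi$, and the output keeps the edges marked by both endpoints. *)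

(* Defs.v *)
From HB Require Import structures.
From mathcomp Require Import all_boot all_order all_algebra.
From mathcomp Require Import boolp reals.

Set Implicit Arguments.
Unset Strict Implicit.
Unset Printing Implicit Defensive.

Import Order.TTheory GRing.Theory Num.Theory.
Local Open Scope ring_scope.

(* A graph on the vertex set V is given by its set of edges, an edge being an
   unordered pair of distinct vertices. *)
Definition vertex_pairs (V : finType) : {set {set V}} := [set e : {set V} | #|e| == 2%N].

Definition simple_graph (V : finType) (E : {set {set V}}) : bool :=
  E \subset vertex_pairs V.

Definition incident (V : finType) (E : {set {set V}}) (v : V) : {set {set V}} :=
  [set e in E | v \in e].

Definition deg (V : finType) (E : {set {set V}}) (v : V) : nat :=
  #|incident E v|.

Definition adj (V : finType) (E : {set {set V}}) : rel V :=
  [rel x y | [set x; y] \in E].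

Definition forest (V : finType) (F : {set {set V}}) : bool :=
  `[< forall c : seq V, (2 < size c)%N -> uniq c -> ~~ cycle (adj F) c >].

Definition forest_partition (V : finType) (E : {set {set V}})
    (P : {set {set {set V}}}) : bool :=
  partition P E && [forall F in P, forest F].

(* The partition of E into single edges is only the starting candidate of the
   minimisation; see arboricity_spec. *)
Definition arboricity (V : finType) (E : {set {set V}}) : nat :=
  #|[arg min_(P < [set [set e] | e in E] | forest_partition E P) #|P|]|.

Lemma forest_partition_set1 (V : finType) (E : {set {set V}}) :
  simple_graph E -> forest_partition E [set [set e] | e in E].
Proof.
move=> sE; apply/andP; split.
  apply/and3P; split.
  - rewrite cover_imset; apply/eqP/setP => e; apply/bigcupP/idP.
      by case=> f fE /set1P ->.
    by move=> eE; exists e => //; rewrite set11.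
  - apply/trivIsetP => _ _ /imsetP[e _ ->] /imsetP[f _ ->] ef.
    rewrite disjoints1 inE; apply: contra ef => /eqP ->; exact: eqxx.
  - by apply/imsetP => -[e _ /setP/(_ e)]; rewrite !inE eqxx.
apply/forall_inP => _ /imsetP[e eE ->]; apply/asboolP.
have e2 : #|e| = 2%N by move/subsetP: sE => /(_ _ eE); rewrite inE => /eqP.
case=> [|x [|y [|z c]]] //= _ /and3P[].
rewrite !inE !negb_or => /and3P[xy xz _] /andP[yz _] _.
apply/negP => /and3P[/set1P exy /set1P eyz _].
have : [set x; y; z] \subset e.
  by rewrite subUset {1}exy subxx sub1set -eyz !inE eqxx orbT.
move/subset_leq_card; rewrite e2 -setUA cardsU1 cards2 yz !inE.
by rewrite (negPf xy) (negPf xz).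
Qed.

Lemma arboricity_spec (V : finType) (E : {set {set V}}) :
  simple_graph E ->
  (exists2 P, forest_partition E P & #|P| = arboricity E) /\
  (forall P, forest_partition E P -> (arboricity E <= #|P|)%N).
Proof.
move=> /forest_partition_set1 P0; rewrite /arboricity.
by case: arg_minnP => // P PP Pmin; split=> //; exists P.
Qed.

Definition bmatching (V : finType) (b : nat) (E F : {set {set V}}) : bool :=
  (F \subset E) && [forall v, (deg F v <= b)%N].

Definition mu (V : finType) (b : nat) (E : {set {set V}}) : nat :=
  \max_(F : {set {set V}} | bmatching b E F) #|F|.

Definition approx_bmatching (R : realType) (V : finType) (b : nat)
    (E : {set {set V}}) (beta zeta : R) (F : {set {set V}}) : bool :=
  bmatching b E F && ((mu b E)%:R / beta - zeta <= #|F|%:R).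

Definition Lambda (R : realType) (alpha eta : R) (b : nat) : R :=
  5 * (1 + 5 / eta) * (2 * alpha) + (b%:R - 1).

(* [Lambda] need not be an integer. For natural L this says that L is one of
   its two roundings (and L = Lambda when Lambda is an integer). *)
Definition rounds (R : realType) (L : nat) (x : R) : bool := `|L%:R - x| < 1.

Definition marking (V : finType) (E : {set {set V}}) (L : nat)
    (mark : V -> {set {set V}}) : Prop :=
  forall v, mark v \subset incident E v /\ #|mark v| = minn (deg E v) L.

Definition marked_by_both (V : finType) (E : {set {set V}})
    (mark : V -> {set {set V}}) : {set {set V}} :=
  [set e in E | [forall v in e, e \in mark v]].

Definition total_order_in (T : finType) (A : {set T}) (pi : rel T) : Prop :=
  [/\ {in A &, total pi}, {in A &, antisymmetric pi}
    & {in A & &, transitive pi}].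

Definition first_edges (V : finType) (pi : rel {set V}) (E : {set {set V}})
    (L : nat) (v : V) : {set {set V}} :=
  [set e in take (minn (deg E v) L) (sort pi (enum (incident E v)))].

Definition ContractionSparsify (V : finType) (pi : rel {set V})
    (E : {set {set V}}) (L : nat) : {set {set V}} :=
  marked_by_both E (first_edges pi E L).

(* Main.v *)
(* Among the maximum b-matchings of G take M with the most edges in H. Call a
   vertex high if its degree exceeds L, and let X be the set of vertices that
   are high or saturated by M. A high vertex v with at least b marked edges
   leaving X cannot be unsaturated (M could be enlarged), nor can v have left an
   edge of M unmarked (that edge could be exchanged for an edge of H outside M).
   Hence every edge of M missing from H ends in the set B of the other high
   vertices, and X consists of B and the saturated vertices, of which there are
   at most 2|M|/b. Each vertex of B has at least L + 1 - b edges inside X, while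
   G has at most arboricity(G) |X| such edges in total; for the given L this
   yields b |B| <= (4/50) eta |M|. *)
Require Import Defs.
From HB Require Import structures.
From mathcomp Require Import all_boot all_order all_algebra.
From mathcomp Require Import boolp reals ring lra.

Set Implicit Arguments.
Unset Strict Implicit.
Unset Printing Implicit Defensive.

Import Order.TTheory GRing.Theory Num.Theory.
Local Open Scope ring_scope.

Section Graphs.

Variable V : finType.
Implicit Types (E F M H : {set {set V}}) (X B : {set V}) (v w x y : V).

(** * Edges of simple graphs, and the edge count of forests *)

Lemma simple_graphP E e : simple_graph E -> e \in E -> #|e| = 2%N.
Proof. by move=> /subsetP sE /sE; rewrite inE => /eqP. Qed.

Lemma simple_graphS E F : F \subset E -> simple_graph E -> simple_graph F.
Proof. exact: subset_trans. Qed.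

Lemma edge_ends E e v : simple_graph E -> e \in E -> v \in e ->
  exists2 w, w != v & e = [set v; w].
Proof.
move=> sE /(simple_graphP sE) /eqP/cards2P[x [y [xy ->]]].
rewrite !inE => /orP[] /eqP ->; first by exists y; rewrite 1?eq_sym.
by exists x => //; rewrite setUC.
Qed.

Lemma forestS E F : F \subset E -> forest E -> forest F.
Proof.
move=> /subsetP FE /asboolP fE; apply/asboolP => c c2 cu.
apply: contra (fE c c2 cu); case: c {c2 cu} => //= x c.
by apply: sub_path => u v /FE.
Qed.

(** Without such a vertex, simple paths starting in [X] could be extended to any length, beyond
    [#|V|]. *)
Lemma forest_leaf F X : simple_graph F -> forest F -> X != set0 ->
  F \subset powerset X -> exists2 x, x \in X & (deg F x <= 1)%N.
Proof.
move=> sF /asboolP fF /set0Pn[x0 x0X] FX; apply/exists_inP.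
have [//|/exists_inPn deg2] := boolP [exists x in X, (deg F x <= 1)%N]; exfalso.
(* Minimum degree two allows every simple path to be prolonged. *)
have long n : exists x c, [/\ x \in X, uniq (x :: c), path (adj F) x c & size c = n].
  elim: n => [|n [x [c [xX cu cp cn]]]]; first by exists x0, [::].
  have := deg2 _ xX; rewrite -ltnNge => /card_gt1P[e [f [+ + ef]]].
  rewrite !inE => /andP[eF xe] /andP[fF' xf].
  have [y yx eE] := edge_ends sF eF xe; have [z zx fE] := edge_ends sF fF' xf.
  have yz : y != z by apply: contra ef => /eqP yz; rewrite eE fE yz.
  (* [head x c] is the second vertex of the path, or [x] itself when [c] is empty. The two
     neighbours [y] and [z] of [x] differ, so at least one of them is not this vertex. *)
  have grow t : t != x -> [set x; t] \in F -> t != head x c ->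
      exists x' c', [/\ x' \in X, uniq (x' :: c'), path (adj F) x' c' & size c' = n.+1].
    move=> tx xtF tc.
    have tX : t \in X.
      have := subsetP FX _ xtF; rewrite powersetE => /subsetP; apply.
      by rewrite !inE eqxx orbT.
    have [tin|tout] := boolP (t \in c); last first.
      exists t, (x :: c); split => //=; last by rewrite cn.
        by rewrite inE negb_or tx tout.
      by rewrite cp andbT /adj /= setUC.
    (* If [t] were already on the path, the stretch from [x] to [t] closed by the edge [[set x; t]]
       would be a cycle. It has length at least 3 because [t] is not the second vertex. *)
    exfalso; case/splitPr: tin cu cp tc => c1 c2.
    case: c1 => [|s c1]; first by rewrite /= eqxx.
    move=> cu cp _; have c3 : (2 < size (x :: rcons (s :: c1) t))%N by rewrite /= size_rcons.
    apply: (fun u => elimN idP (fF _ c3 u)).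
      by move: cu; rewrite -cat_rcons -cat_cons cat_uniq => /andP[].
    rewrite /cycle !rcons_path last_rcons /=.
    move: cp; rewrite cat_path /= => /and3P[/andP[-> ->] -> _].
    by rewrite /adj /= setUC.
  have [yc|] := eqVneq y (head x c); last by apply: grow; rewrite -?eE.
  by apply: (grow z); rewrite -?fE -?yc // eq_sym.
have [x [c [_ cu _ cn]]] := long #|V|.
by have := max_card (mem (x :: c)); rewrite (card_uniqP cu) /= cn ltnn.
Qed.

(** Induction on [#|X|]: deleting a vertex of degree at most 1 loses one vertex and at most one
    edge. *)
Lemma forest_card F X : simple_graph F -> forest F ->
  F \subset powerset X -> (#|F| <= #|X|)%N.
Proof.
have [n] := ubnP #|X|; elim: n => // n IH in F X * => /ltnSE Xn sF fF FX.
have [X0|X0] := eqVneq X set0.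
  have -> : F = set0; last by rewrite cards0.
  apply/setP => e; rewrite inE; apply/negP => eF.
  have := simple_graphP sF eF; have := subsetP FX _ eF.
  by rewrite X0 powersetE subset0 => /eqP ->; rewrite cards0.
have [x xX xF] := forest_leaf sF fF X0 FX.
have FE : F :\: incident F x \subset F by exact: subsetDl.
rewrite -(cardsID (incident F x) F) (cardsD1 x X) xX.
apply: leq_add; first by apply: leq_trans xF; rewrite subset_leq_card ?subsetIr.
apply: IH.
- by move: Xn; rewrite (cardsD1 x X) xX.
- exact: simple_graphS sF.
- exact: forestS fF.
apply/subsetP => e; rewrite !inE => /andP[+ eF]; rewrite eF /= => xe.
by rewrite subsetD1 xe andbT -powersetE (subsetP FX).
Qed.

(** * Density bounded by arboricity, and degree counts *)

Lemma card_bigcup_le (I T : finType) (P : pred I) (A : I -> {set T}) :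
  (#|\bigcup_(i | P i) A i| <= \sum_(i | P i) #|A i|)%N.
Proof.
elim/big_rec2: _ => [|i n D _ le]; first by rewrite cards0.
by apply: leq_trans (leq_card_setU _ _) _; rewrite leq_add2l.
Qed.

(** Each forest of an optimal partition contributes at most [#|X|] edges inside [X]. *)
Lemma arboricity_card E X : simple_graph E ->
  (#|E :&: powerset X| <= arboricity E * #|X|)%N.
Proof.
move=> sE; have [[P /andP[/and3P[/eqP covP _ _] /forall_inP fP] <-] _] := arboricity_spec sE.
rewrite -sum_nat_const.
have sub : E :&: powerset X \subset \bigcup_(F in P) (F :&: powerset X).
  apply/subsetP => e; rewrite inE -{1}covP => /andP[/bigcupP[F FP eF] eX].
  by apply/bigcupP; exists F => //; rewrite inE eF.
apply: leq_trans (subset_leq_card sub) _.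
apply: leq_trans (card_bigcup_le _ _) _; apply: leq_sum => F FP.
have FE : F \subset E by rewrite -covP; exact: bigcup_sup FP.
apply: forest_card; last exact: subsetIr.
  by apply: simple_graphS sE; apply: subset_trans FE; exact: subsetIl.
by apply: forestS (fP _ FP); exact: subsetIl.
Qed.

(** Double counting: an edge is counted once for each of its two ends that lies in [B]. *)
Lemma sum_deg_le E B : simple_graph E -> (\sum_(v in B) deg E v <= 2 * #|E|)%N.
Proof.
move=> sE; under eq_bigr do rewrite /deg -sum1_card.
rewrite (exchange_big_dep (mem E)) /=; last by move=> v e _; rewrite inE => /andP[].
rewrite mulnC -sum_nat_const; apply: leq_sum => e eE.
rewrite sum1_card -(simple_graphP sE eE); apply: subset_leq_card.
by apply/subsetP => v; rewrite unfold_in inE eE => /andP[].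
Qed.

Lemma deg_setU1 M f v : f \notin M -> deg (f |: M) v = ((v \in f) + deg M v)%N.
Proof.
move=> fM; rewrite /deg; have [vf|vf] := boolP (v \in f).
  have -> : incident (f |: M) v = f |: incident M v.
    by apply/setP => e; rewrite !inE; case: eqVneq => // ->; rewrite vf.
  by rewrite cardsU1 inE (negPf fM).
apply: eq_card => e; rewrite !inE; case: eqVneq => // ->.
by rewrite (negPf vf) !andbF.
Qed.

Lemma deg_setD1 M e v : e \in M -> deg M v = ((v \in e) + deg (M :\ e) v)%N.
Proof. by move=> eM; rewrite -{1}(setD1K eM) deg_setU1 // setD11. Qed.

Lemma deg_subset E F v : F \subset E -> (deg F v <= deg E v)%N.
Proof.
by move=> /subsetP FE; apply/subset_leq_card/subsetP => e; rewrite !inE => /andP[/FE ->].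
Qed.

(** * Maximum b-matchings, and the edges of one that a sparsifier can lose *)

Lemma bmatchingP b E F :
  reflect (F \subset E /\ forall v, (deg F v <= b)%N) (bmatching b E F).
Proof.
by apply: (iffP andP) => -[FE /forallP Fb]; split => //; apply/forallP.
Qed.

Lemma bmatchingW b E H F : H \subset E -> bmatching b H F -> bmatching b E F.
Proof.
by move=> HE /bmatchingP[FH Fb]; apply/bmatchingP; split=> //; apply: subset_trans HE.
Qed.

Lemma bmatchingS b E M F : F \subset M -> bmatching b E M -> bmatching b E F.
Proof.
move=> FM /bmatchingP[ME Mb]; apply/bmatchingP; split; first exact: subset_trans ME.
by move=> v; apply: leq_trans (Mb v); exact: deg_subset.
Qed.

Lemma bmatching_setU1 b E M f : bmatching b E M -> f \in E -> f \notin M ->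
  {in f, forall t, (deg M t < b)%N} -> bmatching b E (f |: M).
Proof.
move=> /bmatchingP[ME Mb] fE fM fb; apply/bmatchingP; split.
  by rewrite subUset sub1set fE.
move=> t; rewrite deg_setU1 //; have [/fb //|_] := boolP (t \in f).
exact: Mb.
Qed.

Lemma leq_mu b E F : bmatching b E F -> (#|F| <= mu b E)%N.
Proof. by move=> bF; rewrite /mu; apply: leq_bigmax_cond. Qed.

Lemma mu_subset b E H : H \subset E -> (mu b H <= mu b E)%N.
Proof. by move=> HE; apply/bigmax_leqP => F /(bmatchingW HE)/leq_mu. Qed.

(** The tie-break by [#|M :&: H|] is what rules out exchanging an edge outside [H] for one
    inside. *)
Lemma max_bmatching_extremal b E H : exists M,
  [/\ bmatching b E M, #|M| = mu b E &
      forall N, bmatching b E N -> #|N| = mu b E -> (#|N :&: H| <= #|M :&: H|)%N].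
Proof.
have b0 : bmatching b E set0.
  apply/bmatchingP; split=> [|v]; first exact: sub0set.
  have -> : deg set0 v = 0%N; last by [].
  by apply: eq_card0 => e; rewrite !inE.
have [|M0 bM0 M0mu] := @eq_bigmax_cond _ [pred F | bmatching b E F] (fun F => #|F|).
  by apply/card_gt0P; exists set0.
pose P := [pred F | bmatching b E F && (#|F| == mu b E)].
have PM0 : P M0 by rewrite /P /= -M0mu eqxx andbT.
case: (@arg_maxnP _ M0 P (fun F => #|F :&: H|) PM0) => M /andP[bM /eqP Mmu] Mmax.
by exists M; split => // N bN /eqP Nmu; apply: Mmax; rewrite /= bN Nmu.
Qed.

(* [s] is the number of vertices saturated by [M], and [k] the number of
   vertices of degree above [L] that have fewer than [b] marked edges to
   unsaturated vertices of degree at most [L]. *)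
Lemma marked_by_both_deficit (b L : nat) E H (mark : V -> {set {set V}}) :
  simple_graph E -> marking E L mark -> H = marked_by_both E mark ->
  exists M (s k : nat),
  [/\ [/\ bmatching b E M & #|M| = mu b E], (#|M :\: H| <= k * b)%N,
      (s * b <= 2 * #|M|)%N
    & (k * (L.+1 - b) <= 2 * (arboricity E * (s + k)))%N].
Proof.
move=> sE mk ->; set H' := marked_by_both _ _.
have [M [bM Mmu Mmax]] := max_bmatching_extremal b E H'.
have /bmatchingP[ME Mb] := bM.
pose U := [set v | (L < deg E v)%N].
pose S := [set v | deg M v == b].
pose X := U :|: S.
pose B := [set v in U | (#|mark v :\: powerset X| < b)%N].
have markE v e : e \in mark v -> (e \in E) && (v \in e).
  by have [/subsetP sub _] := mk v => /sub; rewrite inE.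
have markU v : v \notin U -> mark v = incident E v.
  rewrite inE -leqNgt => dv; have [sub c] := mk v.
  by apply/eqP; rewrite eqEcard sub c; move/minn_idPl: dv => ->; exact: leqnn.
have notS v : v \notin S -> (deg M v < b)%N.
  by rewrite inE => vS; rewrite ltn_neqAle vS Mb.
(* Pigeonhole: at least [b] marked edges of [v] leave [X], so one of them avoids [K]. Its far end
   [w] is not high, hence marks all its edges, and the edge survives in [H']. *)
have free v (K : {set {set V}}) : v \in U -> v \notin B -> (#|K| < b)%N ->
    exists f w, [/\ f \in H', f \notin K, f \in mark v, f = [set v; w] & w \notin X].
  rewrite inE => vU; rewrite 2!inE vU /= -leqNgt => bv Kb.
  have : ~~ (mark v :\: powerset X \subset K).
    by apply: contraL Kb => /subset_leq_card; rewrite -leqNgt; apply: leq_trans.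
  case/subsetPn => f; rewrite inE powersetE => /andP[fX fv] fK.
  have /andP[fE vf] := markE _ _ fv.
  have [w wv fvw] := edge_ends sE fE vf.
  have wX : w \notin X.
    apply: contra fX => wX; rewrite fvw subUset !sub1set wX andbT.
    by rewrite !inE vU.
  exists f, w; split => //; rewrite inE fE; apply/forall_inP => t.
  rewrite fvw !inE => /orP[] /eqP ->; rewrite -fvw //.
  have wU : w \notin U by apply: contra wX => wU; rewrite inE wU.
  by rewrite (markU _ wU) inE fE fvw !inE eqxx orbT.
have H'E : H' \subset E by apply/subsetP => e; rewrite inE => /andP[].
(* Take for [K] the edges of [M] at an unsaturated high [v] outside [B]: the edge found has two
   unsaturated ends, so adding it would enlarge [M]. *)
have US : X \subset S :|: B.
  apply/subsetP => v; rewrite inE => /orP[vU|vS]; last by rewrite inE vS.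
  rewrite inE; case: (boolP (v \in S)) => //= vS; apply/negPn/negP => vB.
  have [f [w [fH + fv fvw wX]]] := free v _ vU vB (notS _ vS).
  have /andP[fE vf] := markE _ _ fv; rewrite inE vf andbT => fM.
  have /leq_mu : bmatching b E (f |: M).
    apply: bmatching_setU1 => // t; rewrite fvw !inE => /orP[] /eqP ->.
      exact: notS.
    by apply: notS; apply: contra wX; rewrite [w \in X]inE orbC => ->.
  by rewrite cardsU1 fM Mmu ltnn.
(* An edge [e] of [M] lost in [H'] is unmarked at some end [v], which must be high. If [v] is
   outside [B], taking for [K] the other edges of [M] at [v] gives an [f] to exchange for [e]. *)
have MH : M :\: H' \subset \bigcup_(v in B) incident M v.
  apply/subsetP => e; rewrite inE => /andP[eH eM].
  have eE := subsetP ME _ eM.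
  move: (eH); rewrite inE eE /= => /forall_inPn[v ve ev].
  have vU : v \in U by apply: contraNT ev => /markU ->; rewrite inE eE.
  apply/bigcupP; exists v; last by rewrite inE eM.
  apply/negPn/negP => vB.
  have De := deg_setD1 v eM; rewrite ve add1n in De.
  have Kb : (#|incident (M :\ e) v| < b)%N by have := Mb v; rewrite De.
  have [f [w [fH + fv fvw wX]]] := free v _ vU vB Kb.
  have /andP[fE vf] := markE _ _ fv; rewrite inE vf andbT => fM.
  (* [f] is marked by [v] and [e] is not; so [f] is new to [M], and the exchange keeps the size
     while gaining an edge of [H']. *)
  have fe : f != e by apply: contra ev => /eqP <-.
  have bN : bmatching b E (f |: M :\ e).
    apply: bmatching_setU1 => //; first by apply: bmatchingS bM; exact: subD1set.
    move=> t; rewrite fvw !inE => /orP[] /eqP -> //.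
    apply: leq_ltn_trans (deg_subset _ (subD1set M e)) _.
    by apply: notS; apply: contra wX; rewrite [w \in X]inE orbC => ->.
  have /Mmax/(_ _) : bmatching b E (f |: M :\ e) by [].
  rewrite cardsU1 fM -Mmu (cardsD1 e M) eM => /(_ erefl).
  have -> : (f |: M :\ e) :&: H' = f |: (M :&: H').
    apply/setP => g; rewrite !inE; case: (eqVneq g f) => [->|_] /=.
      by move: fH; rewrite inE.
    by case: (eqVneq g e) => //= ->; move: eH; rewrite inE => /negPf ->; rewrite andbF.
  have fMH : f \notin M :&: H'.
    by apply: contra fM; rewrite !inE fe => /andP[].
  by rewrite cardsU1 fMH ltnn.
exists M, #|S|, #|B|; split => //.
- apply: leq_trans (subset_leq_card MH) _; apply: leq_trans (card_bigcup_le _ _) _.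
  by rewrite -sum_nat_const; apply: leq_sum => v _; exact: Mb.
- apply: leq_trans (sum_deg_le S (simple_graphS ME sE)).
  by rewrite -sum_nat_const; apply: leq_sum => v; rewrite inE => /eqP ->.
have sX : simple_graph (E :&: powerset X) by apply: simple_graphS sE; exact: subsetIl.
apply: leq_trans (_ : 2 * (arboricity E * #|X|) <= _)%N; last first.
  rewrite leq_mul2l leq_mul2l; apply/orP; right; apply/orP; right.
  exact: leq_trans (subset_leq_card US) (leq_card_setU _ _).
apply: leq_trans (_ : 2 * #|E :&: powerset X| <= _)%N; last first.
  by rewrite leq_mul2l arboricity_card.
apply: leq_trans (sum_deg_le B sX); rewrite -sum_nat_const; apply: leq_sum => v.
(* A vertex of [B] marks exactly [L] edges and at most [b - 1] of them leave [X], so at least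
   [L + 1 - b] stay inside. *)
rewrite 2!inE => /andP[vU vb]; rewrite leq_subLR.
have [_ c] := mk v; move/ltnW/minn_idPr: (vU) => mL; rewrite mL in c.
rewrite -{1}c -(cardsID (powerset X)) addnC -addSn leq_add //.
apply: subset_leq_card; apply/subsetP => e; rewrite !inE => /andP[/markE/andP[-> ->] ->].
by [].
Qed.

(** Sorting only permutes the incident edges, so a prefix consists of distinct incident edges and
    has the prescribed size. *)
Lemma marking_first_edges (pi : rel {set V}) E L : marking E L (first_edges pi E L).
Proof.
move=> v; rewrite /first_edges; set s := sort _ _.
have su : uniq s by rewrite sort_uniq enum_uniq.
have sz : size s = deg E v by rewrite size_sort -cardE.
split.
  apply/subsetP => e; rewrite inE => /mem_take.
  by rewrite mem_sort mem_enum.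
rewrite cardsE (card_uniqP (take_uniq _ su)) size_takel // sz.
exact: geq_minl.
Qed.

End Graphs.

(** * The numerical estimate and the transfer of approximations *)

Lemma arboricity0 (V : finType) (E : {set {set V}}) :
  simple_graph E -> arboricity E = 0%N -> E = set0.
Proof.
move=> sE a0; have := arboricity_card setT sE.
by rewrite a0 mul0n leqn0 cards_eq0 powersetT setIT => /eqP.
Qed.

Lemma sparsifier_ratio (R : realType) (V : finType) (G H : {set {set V}})
    (alpha eta : R) (b L : nat) (mark : V -> {set {set V}}) :
  simple_graph G -> (arboricity G)%:R <= alpha -> 0 < eta <= 1 ->
  rounds L (Lambda alpha eta b) ->
  marking G L mark -> H = marked_by_both G mark ->
  (mu b G)%:R <= (1 + eta) * (mu b H)%:R.
Proof.
move=> sG ha /andP[eta0 eta1] hL mk HE.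
have [M [s [k [[bM Mmu] lost sat bad]]]] := marked_by_both_deficit b sG mk HE.
(* Arboricity 0 means no edges at all; otherwise [alpha >= 1], which the estimate below relies
   on. *)
have [a0|a0] := posnP (arboricity G).
  have M0 : M = set0.
    by apply/eqP; rewrite -subset0 -(arboricity0 sG a0); have /bmatchingP[] := bM.
  by rewrite -Mmu M0 cards0 mulr_ge0 ?addr_ge0 ?ler0n ?ltW.
have kept : (#|M :&: H| <= mu b H)%N.
  apply: leq_mu; apply/bmatchingP; split=> [|v]; first exact: subsetIr.
  by have /bmatchingP[_ Mb] := bM; apply: leq_trans (Mb v); apply/deg_subset/subsetIl.
have mE : (mu b G <= mu b H + k * b)%N.
  by rewrite -Mmu -(cardsID H M) leq_add.
(* The subtraction is truncated; this lower bound on [L.+1 - b] holds in either case. *)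
have D : (L.+1 <= b + (L.+1 - b))%N by rewrite -leq_subLR.
move: bad D; set d := (L.+1 - b)%N => bad D.
(* Multiplying by [b] turns [s * b] into at most [2 * mu b G], leaving [k * b], the bound on lost
   edges, as the only unknown. *)
have {}bad : (k * b * d <= 2 * (arboricity G * (2 * mu b G + k * b)))%N.
  rewrite mulnAC; apply: leq_trans (_ : 2 * (arboricity G * (s + k)) * b <= _)%N.
    by rewrite leq_mul2r bad orbT.
  rewrite -mulnA leq_mul2l -mulnA leq_mul2l mulnDl leq_add2r -Mmu sat.
  by rewrite !orbT.
move: bad mE; move: (k * b)%N => x.
rewrite -!(ler_nat R) !natrD !natrM natrD natrM.
move: hL D; rewrite -(ler_nat R) natrD -natr1 /rounds /Lambda ltr_distl => /andP[+ _].
have {}a0 : 1 <= (arboricity G)%:R :> R by rewrite ler1n.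
have x0 : 0 <= x%:R :> R by exact: ler0n.
have m0 : 0 <= (mu b G)%:R :> R by exact: ler0n.
move: (d%:R : R) (x%:R : R) (L%:R : R) (b%:R : R) ((mu b G)%:R : R) ((mu b H)%:R : R)
  ((arboricity G)%:R : R) x0 m0 ha a0 => {}d {}x l c m h a x0 m0 aA a1 lL ld xd mh.
(* With [t] the threshold becomes [10 * alpha + 50 * t + (b - 1)], free of division. Rounding costs
   less than 1, whence the [- 1] in the bound on [d]. *)
pose t := alpha / eta.
have alphaE : alpha = t * eta by rewrite /t divfK ?gt_eqF.
have t0 : 0 < t by rewrite divr_gt0 // (lt_le_trans _ aA) // (lt_le_trans _ a1).
have {}lL : 10 * alpha + 50 * t + (c - 1) - 1 < l.
  apply: le_lt_trans lL; rewrite le_eqVlt; apply/orP; left; apply/eqP.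
  rewrite /t; ring.
have dt : 10 * alpha + 50 * t - 1 <= d by lra.
have {}xd : x * (10 * alpha + 50 * t - 1) <= 2 * (alpha * (2 * m + x)).
  apply: le_trans (ler_wpM2l x0 dt) _; apply: le_trans xd _.
  have : a * (2 * m + x) <= alpha * (2 * m + x).
    by rewrite ler_wpM2r // addr_ge0 // mulr_ge0.
  by lra.
(* Moving [2 * alpha * x] to the left leaves the coefficient [8 * alpha - 1 + 50 * t]; its part
   [8 * alpha - 1] is nonnegative and is dropped. Since [alpha = t * eta], the factor [t]
   cancels. *)
have xt : 50 * x <= 4 * eta * m.
  rewrite -(ler_pM2l t0).
  have : 0 <= x * (8 * alpha - 1) by apply: mulr_ge0 => //; lra.
  by move: xd; rewrite alphaE; lra.
(* As [eta <= 1], [(1 + eta) * x] is at most [8 / 50 * eta * m], hence at most [eta * m]; with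
   [m <= h + x] this gives [m <= (1 + eta) * h]. The products are supplied for linear arithmetic. *)
have : 0 <= (1 + eta) * (4 * eta * m - 50 * x) by apply: mulr_ge0; lra.
have : 0 <= (1 + eta) * (h + x - m) by apply: mulr_ge0; lra.
have : 0 <= (eta * (1 - eta)) * m by rewrite !mulr_ge0 ?subr_ge0 // ltW.
have : 0 <= eta * m by rewrite mulr_ge0 // ltW.
by lra.
Qed.

(** Dividing the ratio by [beta * r] bounds the main term for [G] by that for [H], and [r >= 1]
    makes the additive slack no smaller. *)
Lemma approx_bmatching_transfer (R : realType) (V : finType) (G H F : {set {set V}})
    (b : nat) (r beta zeta : R) :
  H \subset G -> 1 <= r -> (mu b G)%:R <= r * (mu b H)%:R ->
  0 < beta -> 0 <= zeta ->
  approx_bmatching b H beta zeta F ->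
  approx_bmatching b G (beta * r) (zeta * r) F.
Proof.
move=> HG r1 ratio beta0 zeta0 /andP[bF leF]; rewrite /approx_bmatching (bmatchingW HG bF) /=.
have r0 : 0 < r by exact: lt_le_trans r1.
apply: le_trans leF; apply: lerB; last by rewrite ler_peMr.
by rewrite ler_pdivrMr ?mulr_gt0 // mulrA divfK ?gt_eqF // mulrC.
Qed.


Theorem mainTheorem11 (R : realType) (V : finType) (G : {set {set V}})
    (alpha eta : R) (b L : nat)
    (hG : simple_graph G)
    (halpha : (arboricity G)%:R <= alpha)
    (hb : (1 <= b)%N)
    (heta : 0 < eta <= 1)
    (hL : rounds L (Lambda alpha eta b)) :
  (forall (mark : V -> {set {set V}}) (H : {set {set V}}),
     marking G L mark -> H = marked_by_both G mark ->
     [/\ (mu b H <= mu b G)%N,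
         (mu b G)%:R <= (1 + eta) * (mu b H)%:R
       & forall (beta zeta : R) (F : {set {set V}}),
           0 < beta -> 0 <= zeta ->
           approx_bmatching b H beta zeta F ->
           approx_bmatching b G (beta * (1 + eta)) (zeta * (1 + eta)) F])
  /\
  (forall (pi : rel {set V}) (H : {set {set V}}),
     total_order_in (vertex_pairs V) pi -> H = ContractionSparsify pi G L ->
     [/\ (mu b H <= mu b G)%N,
         (mu b G)%:R <= (1 + eta) * (mu b H)%:R
       & forall (beta zeta : R) (F : {set {set V}}),
           0 < beta -> 0 <= zeta ->
           approx_bmatching b H beta zeta F ->
           approx_bmatching b G (beta * (1 + eta)) (zeta * (1 + eta)) F]).
Proof.
(* Both claims are instances of one statement about arbitrary markings, the second for the marking
   by first edges. *)
have H mark : marking G L mark ->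
    let K := marked_by_both G mark in
    [/\ (mu b K <= mu b G)%N, (mu b G)%:R <= (1 + eta) * (mu b K)%:R
      & forall (beta zeta : R) (F : {set {set V}}), 0 < beta -> 0 <= zeta ->
        approx_bmatching b K beta zeta F ->
        approx_bmatching b G (beta * (1 + eta)) (zeta * (1 + eta)) F].
  move=> mk K; have KG : K \subset G by apply/subsetP => e; rewrite inE => /andP[].
  have ratio : (mu b G)%:R <= (1 + eta) * (mu b K)%:R.
    exact: (sparsifier_ratio hG halpha heta hL mk).
  split => // [|beta zeta F]; first exact: mu_subset.
  apply: approx_bmatching_transfer => //.
  by case/andP: heta => /ltW; rewrite lerDl.
split=> [mark K mk ->|pi K _ ->]; first exact: H.
by apply: H; exact: marking_first_edges.
Qed.
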